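(* Let $G$ be a finite simple graph on $n\geq 2$ vertices with minimum degree $\delta(G)$, and let $k\geq 2$ be an integer. Then $C_{k}(G)\geq \delta(G)-k+3$. Moreover, this bound is sharp: for every $n$ and every integer $k$ with $2\leq k\leq n-1$, the complete graph $K_n$ satisfies $C_k(K_n)=\delta(K_n)-k+3=n-k+2$.
   Context: All graphs are finite and simple. For a positive integer $k$, a set $S\subseteq V(G)$ is a $k$-dominating set of $G$ if every vertex $v\in V(G)\setminus S$ has at least $k$ neighbors in $S$. Two disjoint sets $A,B\subseteq V(G)$ form a $k$-coalition if neither $A$ nor $B$ is a $k$-dominating set of $G$ but $A\cup B$ is a $k$-dominating set of $G$. A $k$-coalition partition of $G$ is a partition $\Theta$ of $V(G)$ such that every set in $\Theta$ is either a $k$-dominating set of cardinality $k$ or forms a $k$-coalition with another set of $\Theta$. The $k$-coalition number $C_k(G)$ is the maximum cardinality of a $k$-coalition partition of $G$. *)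

(* Defs.v *)
From mathcomp Require Import all_boot all_order all_algebra.

Set Implicit Arguments.
Unset Strict Implicit.
Unset Printing Implicit Defensive.

Record sgraph := SGraph {
  vertex :> finType;
  adj : rel vertex;
  adj_sym : symmetric adj;
  adj_irrefl : irreflexive adj
}.

Definition neighbors (G : sgraph) (v : G) : {set G} := [set u | adj v u].

Definition degree (G : sgraph) (v : G) : nat := #|neighbors v|.

(* Every degree is smaller than #|G|, so the default value #|G| never affects
   the minimum of a nonempty graph. *)
Definition min_degree (G : sgraph) : nat := \big[minn/#|G|]_(v : G) degree v.

Definition k_dominating (G : sgraph) (k : nat) (S : {set G}) : bool :=
  [forall (v | v \notin S), k <= #|neighbors v :&: S|].

Definition k_coalition (G : sgraph) (k : nat) (A B : {set G}) : bool :=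
  [&& [disjoint A & B], ~~ k_dominating k A, ~~ k_dominating k B
    & k_dominating k (A :|: B)].

Definition k_coalition_partition (G : sgraph) (k : nat)
    (Theta : {set {set G}}) : bool :=
  partition Theta [set: G] &&
  [forall A in Theta,
     (k_dominating k A && (#|A| == k)) ||
     [exists B in Theta, (B != A) && k_coalition k A B]].

(* The value is 0 when G has no k-coalition partition. *)
Definition coalition_number (G : sgraph) (k : nat) : nat :=
  \max_(Theta : {set {set G}} | k_coalition_partition k Theta) #|Theta|.

Definition complete_adj (n : nat) : rel 'I_n := fun i j => i != j.

Lemma complete_adj_sym (n : nat) : symmetric (@complete_adj n).
Proof. by move=> i j; rewrite /complete_adj eq_sym. Qed.

Lemma complete_adj_irrefl (n : nat) : irreflexive (@complete_adj n).
Proof. by move=> i; rewrite /complete_adj eqxx. Qed.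

Definition complete_graph (n : nat) : sgraph :=
  SGraph (@complete_adj_sym n) (@complete_adj_irrefl n).

(* Main.v *)
(** Lower bound: let v have minimum degree d and let T consist of v and of
    d - k + 1 of its neighbors (none if d < k).  Each vertex of a set U has at most #|U| - 1
    neighbors inside U, so the complement of any set of d - k + 1 vertices is
    k-dominating, whereas v has at most k - 1 neighbors outside T.  Hence ~: T and
    the singletons of T form a k-coalition partition.
    Upper bound: if k <= #|G|, then k-dominating sets have at least k vertices,
    so some one or two parts cover at least k vertices and there are at most
    #|G| - k other parts; for complete graphs the two bounds agree. *)
Require Import Defs.
From mathcomp Require Import all_boot all_order all_algebra.
From mathcomp Require Import zify.

Set Implicit Arguments.
Unset Strict Implicit.
Unset Printing Implicit Defensive.

Import Order.TTheory GRing.Theory Num.Theory.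
Local Open Scope ring_scope.

Lemma bigminn_leq (I : eqType) (s : seq I) (F : I -> nat) (m : nat) (i : I) :
  i \in s -> (\big[minn/m]_(j <- s) F j <= F i)%N.
Proof.
elim: s => // j s IHs; rewrite inE big_cons geq_min.
by case/predU1P => [-> | /IHs ->]; rewrite ?leqnn ?orbT.
Qed.

(** Parts are nonempty, so each one other than [A] and [B] contributes an element outside [A :|: B].
    Allowing [A = B] also covers a single dominating part. *)
Lemma card_partition_setU (T : finType) (D : {set T}) (P : {set {set T}})
    (A B : {set T}) :
    partition P D -> A \in P -> B \in P ->
  (#|P| + #|A :|: B| <= #|D| + 2)%N.
Proof.
move=> partP AP BP; have sum_ge (Q : {set {set T}}) :
    Q \subset P -> (#|Q| <= \sum_(C in Q) #|C|)%N.
  move=> /subsetP QP; rewrite -sum1_card; apply: leq_sum => C /QP CP.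
  by rewrite card_gt0 (partition_neq0 partP).
rewrite (card_partition partP) (big_setD1 A) //= (cardsD1 A P) AP.
have [<- | neqBA] := eqVneq A B.
  rewrite setUid; have := sum_ge _ (subD1set P A).
  (* [set] identifies terms that are only convertible, which [lia] does not. *)
  set p := #|P :\ A|; set t := (\sum_(C in P :\ A) #|C|)%N; lia.
have BPA : B \in P :\ A by rewrite !inE eq_sym neqBA.
rewrite (big_setD1 B) //= (cardsD1 B (P :\ A)) BPA cardsU.
have := sum_ge (P :\ A :\ B) (subset_trans (subD1set _ _) (subD1set _ _)).
set p := #|P :\ A :\ B|; set t := (\sum_(C in P :\ A :\ B) #|C|)%N; lia.
Qed.

Section Graph.
Variables (G : sgraph) (k : nat).
Implicit Types (v : G) (A B S T U : {set G}).

Lemma degree_lt_card v : (degree v < #|G|)%N.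
Proof.
have vNv : neighbors v \subset [set~ v].
  by apply/subsetP => u; rewrite !inE; apply: contraTneq => ->; rewrite adj_irrefl.
have := subset_leq_card vNv; rewrite cardsC1 /degree.
have : (0 < #|G|)%N by apply/card_gt0P; exists v.
lia.
Qed.

Lemma min_degree_leq v : (min_degree G <= degree v)%N.
Proof. exact/bigminn_leq/mem_index_enum. Qed.

Lemma min_degree_attained : (0 < #|G|)%N -> exists v, degree v = min_degree G.
Proof.
case/card_gt0P => v0 _; case: (@arg_minnP _ v0 xpredT (@degree G)) => // v _ minv.
exists v; apply/eqP; rewrite eqn_leq min_degree_leq andbT /min_degree.
(* [degree v] is a lower bound of every operand; the first case is the default value [#|G|], which
   exceeds all degrees. *)
elim/big_ind: _ => [|x y lex ley|u _]; last exact: minv.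
  exact/ltnW/degree_lt_card.
by rewrite leq_min lex.
Qed.

Lemma k_dominating_setC T :
  (forall v, v \in T -> (k <= #|neighbors v :\: T|)%N) -> k_dominating k (~: T).
Proof.
by move=> domT; apply/forall_inP => v; rewrite inE negbK -setDE; apply: domT.
Qed.

Lemma k_dominating_small_setC T :
  (#|T| <= min_degree G + 1 - k)%N -> k_dominating k (~: T).
Proof.
move=> leT; apply: k_dominating_setC => v vT.
have : (#|neighbors v :&: T| <= #|T :\ v|)%N.
  apply/subset_leq_card/subsetP => u; rewrite !inE => /andP[vu ->].
  by rewrite andbT; apply: contraTneq vu => ->; rewrite adj_irrefl.
have := cardsID T (neighbors v); have := min_degree_leq v.
(* As [v] lies in [T], the bound on [#|T|] is positive, so its subtraction is not truncated. *)
have := cardsD1 v T; rewrite vT /degree; lia.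
Qed.

Lemma k_dominating_set1 v :
  (2 <= #|G|)%N -> (2 <= k)%N -> ~~ k_dominating k [set v].
Proof.
move=> G_gt1 k_gt1; apply/negP => /forall_inP domv.
(* Any vertex [u] other than [v] has at most one neighbor in [[set v]], fewer than [k]. *)
have /card_gt0P[u] : (0 < #|[set~ v]|)%N by rewrite cardsC1; lia.
rewrite inE => /domv; have := subset_leq_card (subsetIr (neighbors u) [set v]).
rewrite cards1; lia.
Qed.

Lemma k_coalition_sym A B : k_coalition k A B = k_coalition k B A.
Proof. by rewrite /k_coalition disjoint_sym setUC; congr (_ && _); rewrite andbCA. Qed.

Lemma setC_singletons_partition T :
    T != set0 -> ~: T != set0 ->
  partition (~: T |: [set [set x] | x in T]) [set: G].
Proof.
move=> T_neq0 TC_neq0; apply/and3P; split.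
- apply/eqP/setP => x; rewrite inE; apply/bigcupP.
  case: (boolP (x \in T)) => [xT | xNT].
    by exists [set x]; rewrite ?set11 // setU1r // imset_f.
  by exists (~: T); rewrite ?inE ?eqxx.
- apply/trivIsetP => A B; rewrite !inE => AP BP neqAB.
  case/predU1P: AP BP neqAB => [-> | /imsetP[x xT ->]];
    case/predU1P => [-> | /imsetP[y yT ->]] neq.
  + by rewrite eqxx in neq.
  + by rewrite disjoint_sym disjoints1 inE yT.
  + by rewrite disjoints1 inE xT.
  + by rewrite disjoints1 inE; apply: contraNneq neq => ->.
- rewrite !inE negb_or eq_sym TC_neq0; apply/imsetP => -[x _ /setP/(_ x)].
  by rewrite !inE eqxx.
Qed.

Lemma setC_notin_singletons T : ~: T \notin [set [set x] | x in T].
Proof.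
by apply/imsetP => -[x xT /setP/(_ x)]; rewrite !inE xT eqxx.
Qed.

Lemma card_setC_singletons T : #|~: T |: [set [set x] | x in T]| = #|T|.+1.
Proof. by rewrite cardsU1 setC_notin_singletons card_imset //; apply: set1_inj. Qed.

(** Each singleton has [~: T] as its partner, and [~: T] may take any of them, because [~: T :|:
    [set x]] equals [~: (T :\ x)]. *)
Lemma setC_singletons_coalition_partition T :
    T != set0 -> ~: T != set0 -> ~~ k_dominating k (~: T) ->
    (forall x, x \in T -> ~~ k_dominating k [set x]) ->
    (forall x, x \in T -> k_dominating k (~: (T :\ x))) ->
  k_coalition_partition k (~: T |: [set [set x] | x in T]).
Proof.
move=> T_neq0 TC_neq0 ndomC ndom1 domU.
have coal x : x \in T -> k_coalition k (~: T) [set x].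
  move=> xT; rewrite /k_coalition disjoint_sym disjoints1 inE xT ndomC ndom1 //.
  by have := domU x xT; rewrite setCD.
have neqC x : x \in T -> [set x] != ~: T.
  by move=> xT; apply: contraNneq (setC_notin_singletons T) => <-; apply: imset_f.
apply/andP; split; first exact: setC_singletons_partition.
apply/forall_inP => A; rewrite !inE => AP; apply/orP; right.
case/predU1P: AP => [-> | /imsetP[x xT ->]].
  have [x xT] := set0Pn _ T_neq0.
  by apply/exists_inP; exists [set x]; rewrite ?neqC ?coal // setU1r // imset_f.
by apply/exists_inP; exists (~: T);
  rewrite ?setU11 // eq_sym neqC // k_coalition_sym coal.
Qed.

Lemma coalition_number_lower :
  (2 <= #|G|)%N -> (2 <= k)%N ->
  (min_degree G + 3 <= coalition_number G k + k)%N.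
Proof.
move=> G_gt1 k_gt1.
have [v degv] : exists v, degree v = min_degree G.
  by apply: min_degree_attained; lia.
(* If [min_degree G < k], truncation gives [d = 0] and [T = [set v]]; the two resulting parts
   suffice, as the claimed bound is then at most 2. *)
pose d := (min_degree G + 1 - k)%N.
have /card_geqP[s [s_uniq szs sN]] : (d <= #|neighbors v|)%N.
  by rewrite /d -degv /degree; lia.
pose N := [set x in s]; pose T := v |: N.
have NsubN : N \subset neighbors v.
  by apply/subsetP => u; rewrite inE => /sN.
have vNN : v \notin N.
  by apply: contraFN (adj_irrefl v) => /(subsetP NsubN); rewrite inE.
have cardN : #|N| = d by rewrite cardsE (card_uniqP s_uniq).
have cardT : #|T| = d.+1 by rewrite cardsU1 vNN cardN.
have T_neq0 : T != set0 by rewrite -card_gt0 cardT.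
have degv_lt := degree_lt_card v.
have TC_neq0 : ~: T != set0.
  (* Since [k >= 2], [d.+1] is either 1 or at most [degree v], hence below [#|G|] in both cases. *)
  by rewrite -card_gt0; have := cardsC T; rewrite cardT /d; lia.
have ndomTC : ~~ k_dominating k (~: T).
  apply/negP => /forall_inP/(_ v); rewrite !inE eqxx => /(_ isT).
  have /subset_leq_card : neighbors v :&: ~: T \subset neighbors v :\: N.
    by rewrite setDE setIS // setCS subsetUr.
  rewrite cardsD (setIidPr NsubN) cardN -/(degree v) /d; lia.
have partT := setC_singletons_coalition_partition T_neq0 TC_neq0 ndomTC
  (fun x _ => k_dominating_set1 x G_gt1 k_gt1).
have /partT : forall x, x \in T -> k_dominating k (~: (T :\ x)).
  move=> x xT; apply: k_dominating_small_setC.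
  by have := cardsD1 x T; rewrite xT cardT -/d; lia.
move/(@leq_bigmax_cond _ _ (fun P : {set {set G}} => #|P|)).
rewrite card_setC_singletons cardT -/(coalition_number G k) /d; lia.
Qed.

Lemma k_dominating_card S :
  (k <= #|G|)%N -> k_dominating k S -> (k <= #|S|)%N.
Proof.
move=> k_le domS; case: (set_0Vmem (~: S)) => [S0 | [v]].
  by rewrite -(cardsC S) S0 cards0 addn0 in k_le.
rewrite inE => /(forall_inP domS) k_le'.
exact: leq_trans k_le' (subset_leq_card (subsetIr _ _)).
Qed.

Lemma coalition_number_upper :
  (0 < #|G|)%N -> (k <= #|G|)%N -> (coalition_number G k + k <= #|G| + 2)%N.
Proof.
move=> G_gt0 k_le.
(* The maximum is isolated so that it can be bounded partition by partition; [k <= #|G|] keeps the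
   subtraction exact. *)
suff : (coalition_number G k <= #|G| + 2 - k)%N by lia.
apply/bigmax_leqP => P /andP[partP /forall_inP coalP].
have [v _] := card_gt0P G_gt0.
have AP : pblock P v \in P by rewrite pblock_mem // (cover_partition partP) inE.
(* When the block of [v] is itself dominating, [B] is that same block. *)
have [B BP] : exists2 B, B \in P & k_dominating k (pblock P v :|: B).
  have /orP[/andP[domA _] |
    /exists_inP[B BP /andP[_ /and4P[_ _ _ domU]]]] := coalP _ AP.
    by exists (pblock P v); rewrite ?setUid.
  by exists B.
move/(k_dominating_card k_le).
have := card_partition_setU partP AP BP; rewrite cardsT; lia.
Qed.

End Graph.

Lemma degree_complete n (v : complete_graph n) : degree v = n.-1.
Proof.
rewrite /degree; have -> : neighbors v = [set~ v].
  by apply/setP => u; rewrite !inE eq_sym.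
by rewrite cardsC1 card_ord.
Qed.

Lemma min_degree_complete n :
  (0 < n)%N -> min_degree (complete_graph n) = n.-1.
Proof.
move=> n_gt0; have [|v <-] := @min_degree_attained (complete_graph n).
  by rewrite card_ord.
exact: degree_complete.
Qed.

Theorem theorem2p1 :
  (forall (G : sgraph) (k : nat), (2 <= #|G|)%N -> (2 <= k)%N ->
     (min_degree G)%:Z - k%:Z + 3 <= (coalition_number G k)%:Z) /\
  (forall n k : nat, (2 <= k <= n - 1)%N ->
     (coalition_number (complete_graph n) k)%:Z
       = (min_degree (complete_graph n))%:Z - k%:Z + 3 /\
     (min_degree (complete_graph n))%:Z - k%:Z + 3 = n%:Z - k%:Z + 2).
Proof.
split=> [G k G_gt1 k_gt1 | n k /andP[k_gt1 k_lt]].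
  have := coalition_number_lower G_gt1 k_gt1; lia.
have cardK : #|complete_graph n| = n by rewrite card_ord.
have lower : (min_degree (complete_graph n) + 3
    <= coalition_number (complete_graph n) k + k)%N.
  by apply: coalition_number_lower => //; rewrite cardK; lia.
have upper : (coalition_number (complete_graph n) k + k <= n + 2)%N.
  by rewrite -[in leqRHS]cardK; apply: coalition_number_upper; rewrite cardK; lia.
(* The range of [k] forces [n >= 3], so [n.-1 + 3 = n + 2] and the two bounds meet. *)
have := @min_degree_complete n; lia.
Qed.
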